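(* Let $F$ be a field of characteristic $p>0$. Let $X=\{\mathfrak D_{i_j}\}_{j=0}^\infty$ be a null sequence of divided elements, let $E=\{e_j(x)\}_{j=0}^\infty$ be a sequence of additive polynomials in $F[x]$, and define $$f_{X,E}(x)=1+\sum_j e_j(x)\mathfrak D_{i_j}\,.$$ Then the element $f_{X,E}(x)$ lies in $\mathfrak{BD}^\ast$.
   Context: $F[x]\{\{\mathfrak D\}\}$ is the commutative ring of formal series $\sum_{i\ge0}a_i\mathfrak D_i$ ($a_i\in F[x]$) with coefficientwise addition and multiplication determined by $\mathfrak D_i\cdot\mathfrak D_j=\binom{i+j}{j}\mathfrak D_{i+j}$; its unit is $\mathfrak D_0=1$. The symbols $\mathfrak D_i$ are called divided elements. A sequence $\{\mathfrak D_{i_j}\}_{j=0}^\infty$ of divided elements is a null sequence if and only if $\mathfrak D_{i_j}\cdot\mathfrak D_{i_t}=0$ for all $j$ and $t$ (where $j=t$ is permitted). A polynomial $f(x)\in F[x]$ is additive if $f(x+y)=f(x)+f(y)$ for all $x,y$ in the algebraic closure of $F$, equivalently if it contains only monomials of the form $cx^{p^n}$. A sequence $P=\{p_i(x)\}_{i=0}^\infty$ in $F[x]$ satisfies the Binomial Theorem if $p_n(x+y)=\sum_{i=0}^n\binom ni p_i(x)p_{n-i}(y)$ for all $n\ge0$; it is nontrivial if not all $p_i(x)$ are zero. $\mathfrak{BD}^\ast$ is the set of all generating functions $\sum_{i\ge0}p_i(x)\mathfrak D_i\in F[x]\{\{\mathfrak D\}\}$ of nontrivial sequences $P$ satisfying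 the Binomial Theorem. *)

(* Defs.v *)
From HB Require Import structures.
From mathcomp Require Import all_boot all_order all_algebra.
From mathcomp Require Import boolp classical_sets functions cardinality fsbigop.

Set Implicit Arguments.
Unset Strict Implicit.
Unset Printing Implicit Defensive.

Import GRing.Theory.
Local Open Scope ring_scope.
Local Open Scope classical_set_scope.

(* [DPSeries a] is the formal divided power series \sum_i a_i D_i over A
   (A{{D}}); it is a record rather than an alias of [nat -> A] so that it does
   not inherit the pointwise product of functions. *)
Record dpseries (A : Type) := DPSeries { dpcoef : nat -> A }.

Lemma dpseriesP (A : Type) (f g : dpseries A) :
  (forall n, dpcoef f n = dpcoef g n) -> f = g.
Proof. by case: f g => [f] [g] /= fg; congr DPSeries; apply/funext. Qed.

HB.instance Definition _ (A : Type) := gen_eqMixin (dpseries A).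
HB.instance Definition _ (A : Type) := gen_choiceMixin (dpseries A).

Section DPSeriesRing.
Variable A : comNzRingType.
Implicit Types f g h : dpseries A.

Definition dp_zero : dpseries A := DPSeries (fun=> 0).
Definition dp_opp f := DPSeries (fun n => - dpcoef f n).
Definition dp_add f g := DPSeries (fun n => dpcoef f n + dpcoef g n).
Definition dp_elem k : dpseries A := DPSeries (fun n => (n == k)%:R).

(* D_i * D_j = 'C(i + j, j) D_(i + j), extended bilinearly to series. *)
Definition dp_mul f g := DPSeries (fun n =>
  \sum_(i < n.+1) (dpcoef f i * dpcoef g (n - i)) *+ 'C(n, i)).

Definition dp_scale (a : A) f := DPSeries (fun n => a * dpcoef f n).

Fact dp_addA : associative dp_add.
Proof. by move=> f g h; apply: dpseriesP => n /=; rewrite addrA. Qed.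
Fact dp_addC : commutative dp_add.
Proof. by move=> f g; apply: dpseriesP => n /=; rewrite addrC. Qed.
Fact dp_add0 : left_id dp_zero dp_add.
Proof. by move=> f; apply: dpseriesP => n /=; rewrite add0r. Qed.
Fact dp_addN : left_inverse dp_zero dp_opp dp_add.
Proof. by move=> f; apply: dpseriesP => n /=; rewrite addNr. Qed.

HB.instance Definition _ := GRing.isZmodule.Build (dpseries A)
  dp_addA dp_addC dp_add0 dp_addN.

Fact dp_mulC : commutative dp_mul.
Proof.
move=> f g; apply: dpseriesP => n /=; rewrite (reindex_inj rev_ord_inj) /=.
apply: eq_bigr => i _; have le_in : (i <= n)%N by rewrite -ltnS.
by rewrite subSS subKn // mulrC bin_sub.
Qed.

Fact dp_mul1 : left_id (dp_elem 0) dp_mul.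
Proof.
move=> f; apply: dpseriesP => n /=; rewrite big_ord_recl /= subn0 mul1r bin0.
by rewrite big1 ?addr0 // => i _; rewrite mul0r mul0rn.
Qed.

Fact dp_mulDl : left_distributive dp_mul dp_add.
Proof.
move=> f g h; apply: dpseriesP => n /=; rewrite -big_split /=.
by apply: eq_bigr => i _; rewrite mulrDl mulrnDl.
Qed.

Fact bin_mul_swap n j k : (j + k <= n)%N ->
  ('C(n, j) * 'C(n - j, k) = 'C(n, k) * 'C(n - k, j))%N.
Proof.
suff tri a b : (a + b <= n)%N ->
    ('C(n, a) * 'C(n - a, b) * (a`! * b`! * (n - (a + b))`!) = n`!)%N.
  move=> le_n; have le_n' : (k + j <= n)%N by rewrite addnC.
  have fact_pos : (0 < j`! * k`! * (n - (j + k))`!)%N.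
    by rewrite !muln_gt0 !fact_gt0.
  apply/eqP; rewrite -(eqn_pmul2r fact_pos) tri // (mulnC j`!) (addnC j).
  by rewrite tri.
move=> le_n; have le_an : (a <= n)%N := leq_trans (leq_addr _ _) le_n.
have le_b : (b <= n - a)%N by rewrite leq_subRL.
by rewrite -(bin_fact le_an) -(bin_fact le_b) subnDA -!mulnA; congr muln;
  rewrite mulnCA.
Qed.

Fact dp_mulA : associative dp_mul.
Proof.
move=> f g h; rewrite (dp_mulC (dp_mul f g) h) (dp_mulC g h).
apply: dpseriesP => n /=.
pose c3 (j k : nat) := (dpcoef f j * (dpcoef h k * dpcoef g (n - (j + k))))
  *+ ('C(n, j) * 'C(n - j, k)).
transitivity (\sum_(j < n.+1) \sum_(k < n.+1 | (k <= n - j)%N) c3 j k).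
  apply: eq_bigr => /= j _; rewrite big_distrr -sumrMnl /=.
  rewrite (big_ord_narrow_leq (leq_subr _ _)) /=.
  apply: eq_bigr => k _.
  by rewrite /c3 mulrnAr -mulrnA mulnC subnDA.
rewrite (exchange_big_dep predT) //=; apply: eq_bigr => k _.
have le_kn : (k <= n)%N by rewrite -ltnS.
transitivity (\sum_(j < n.+1 | (j <= n - k)%N) c3 j k).
  apply: eq_bigl => j; have le_jn : (j <= n)%N by rewrite -ltnS.
  by rewrite !leq_subRL // addnC.
rewrite (big_ord_narrow_leq (leq_subr _ _)) /= big_distrr -sumrMnl /=.
apply: eq_bigr => j _; rewrite /c3 mulrnAr -mulrnA mulrCA -subnDA (addnC k).
have le_jk : (j + k <= n)%N by rewrite addnC -leq_subRL // -ltnS.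
by rewrite bin_mul_swap // mulnC.
Qed.

Fact dp_1_neq0 : dp_elem 0 != 0 :> dpseries A.
Proof. by apply/eqP => /(congr1 (fun f : dpseries A => dpcoef f 0))/eqP; rewrite oner_eq0. Qed.

HB.instance Definition _ := GRing.Zmodule_isComNzRing.Build (dpseries A)
  dp_mulA dp_mulC dp_mul1 dp_mulDl dp_1_neq0.

Fact dp_scaleA a b f : dp_scale a (dp_scale b f) = dp_scale (a * b) f.
Proof. by apply: dpseriesP => n /=; rewrite mulrA. Qed.
Fact dp_scale1 : left_id 1 dp_scale.
Proof. by move=> f; apply: dpseriesP => n /=; rewrite mul1r. Qed.
Fact dp_scaleDr : right_distributive dp_scale +%R.
Proof. by move=> a f g; apply: dpseriesP => n /=; rewrite mulrDr. Qed.
Fact dp_scaleDl f : {morph dp_scale^~ f : a b / a + b}.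
Proof. by move=> a b; apply: dpseriesP => n /=; rewrite mulrDl. Qed.

HB.instance Definition _ := GRing.Zmodule_isLmodule.Build A (dpseries A)
  dp_scaleA dp_scale1 dp_scaleDr dp_scaleDl.

Fact dp_scaleAl a f g : a *: (f * g) = (a *: f) * g.
Proof.
apply: dpseriesP => n /=; rewrite mulr_sumr; apply: eq_bigr => i _.
by rewrite -mulrA mulrnAr.
Qed.

HB.instance Definition _ :=
  GRing.Lmodule_isLalgebra.Build A (dpseries A) dp_scaleAl.

End DPSeriesRing.

Notation "''DP_' i" := (dp_elem _ i) (at level 8, i at level 2, format "''DP_' i").

Lemma dp_elem0 (A : comNzRingType) : 'DP_0 = 1 :> dpseries A.
Proof. by []. Qed.

Lemma dp_elemM (A : comNzRingType) i j :
  'DP_i * 'DP_j = 'C(i + j, j)%:R *: 'DP_(i + j) :> dpseries A.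
Proof.
apply: dpseriesP => n /=; have [->|ne_n] := eqVneq n (i + j)%N.
  have lt_i : (i < (i + j).+1)%N by rewrite ltnS leq_addr.
  rewrite (bigD1 (Ordinal lt_i)) //= !eqxx addKn eqxx !mulr1 big1 ?addr0.
    by rewrite -(bin_sub (leq_addl i j)) addnK.
  by move=> k /negPf; rewrite -val_eqE /= => ->; rewrite mul0r mul0rn.
rewrite mulr0 big1 // => k _; have [ki|_] := eqVneq (k : nat) i; last first.
  by rewrite mul0r mul0rn.
have [nkj|_] := eqVneq (n - k)%N j; last by rewrite mulr0 mul0rn.
have le_kn : (k <= n)%N by rewrite -ltnS.
by rewrite -ki -nkj subnKC // eqxx in ne_n.
Qed.

(* Infinite sums are taken coefficientwise, with A discrete: the family u can
   be summed when each coefficient receives finitely many nonzero terms.  For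
   other families [dp_sum] returns a junk value (see fsbigop). *)
Definition dp_summable (A : comNzRingType) (u : nat -> dpseries A) : Prop :=
  forall n, finite_set [set j | dpcoef (u j) n != 0].

Definition dp_sum (A : comNzRingType) (u : nat -> dpseries A) : dpseries A :=
  DPSeries (fun n => \sum_(j \in [set: nat]) dpcoef (u j) n).

Lemma dp_summable_inj (A : comNzRingType) (i : nat -> nat) (a : nat -> A) :
  injective i -> dp_summable (fun j => a j *: 'DP_(i j)).
Proof.
move=> inj_i n; apply: (@sub_finite_set _ _ (i @^-1` [set n])) => [j /=|].
  by have [//|_] := eqVneq n (i j); rewrite mulr0 eqxx.
by apply: finite_preimage => [x y _ _ /inj_i //|]; exact: finite_set1.
Qed.

Lemma dp_expansion (A : comNzRingType) (a : nat -> A) :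
  DPSeries a = dp_sum (fun i => a i *: 'DP_i).
Proof.
apply: dpseriesP => n /=; rewrite -(fsbig_widen [set n] setT) //=; last first.
  by move=> j [_ /= /eqP]; rewrite eq_sym => /negPf ->; rewrite mulr0.
by rewrite fsbig_set1 eqxx mulr1.
Qed.

Definition null_seq (A : comNzRingType) (X : nat -> dpseries A) : Prop :=
  forall j t, X j * X t = 0.

(* Fbar is algebraically closed by its type, so this makes it an algebraic
   closure of F. *)
Definition is_alg_closure (F : fieldType) (Fbar : closedFieldType)
    (iota : {rmorphism F -> Fbar}) : Prop :=
  forall z, algebraicOver iota z.

Definition additive_poly (F : fieldType) (Fbar : closedFieldType)
    (iota : {rmorphism F -> Fbar}) (f : {poly F}) : Prop :=
  forall x y : Fbar,
    (map_poly iota f).[x + y] = (map_poly iota f).[x] + (map_poly iota f).[y].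

(* The identities hold in F[y][x], x and y independent indeterminates: [poly_XaY q] is
   q(x + y), [q^:P] is q(x) and [q%:P] is q(y). *)
Definition binomial_seq (F : fieldType) (P : nat -> {poly F}) : Prop :=
  forall n, poly_XaY (P n) =
    \sum_(i < n.+1) ((P i)^:P * (P (n - i)%N)%:P) *+ 'C(n, i).

Definition nontrivial_seq (F : fieldType) (P : nat -> {poly F}) : Prop :=
  exists i, P i != 0.

Definition BDstar (F : fieldType) : set (dpseries {poly F}) :=
  [set DPSeries P | P in [set P | binomial_seq P /\ nontrivial_seq P]].

Definition f_XE (F : fieldType) (i : nat -> nat) (e : nat -> {poly F}) :
    dpseries {poly F} :=
  1 + dp_sum (fun j => e j *: 'DP_(i j)).

Arguments dp_elem A k : clear implicits.
Arguments BDstar F : clear implicits.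

(* Main.v *)
(* The n-th coefficient q_n of the sum is a sum
   of additive polynomials, hence additive.  In the binomial identity for
   1 + \sum_n q_n D_n, the terms i = 0 and i = n give q_n(x) + q_n(y), and a
   term with 0 < i < n and q_i q_(n-i) <> 0 has both indices in the null
   sequence, so that its binomial coefficient vanishes in F. *)
Require Import Defs.
From mathcomp Require Import all_boot all_order all_algebra.
From mathcomp Require Import boolp classical_sets functions cardinality fsbigop.

Import GRing.Theory.
Local Open Scope ring_scope.
Local Open Scope classical_set_scope.

Lemma closed_poly_eq0 (K : closedFieldType) (q : {poly K}) :
  (forall x, q.[x] = 0) -> q = 0.
Proof.
move=> q0; apply/eqP/negPn/negP => /closed_nonrootP[x].
by rewrite rootE q0 eqxx.
Qed.

(** For fixed [x] the polynomial [u.[x%:P]] in the inner variable vanishes everywhere, hence is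
    zero. Its [j]-th coefficient is that of [swapXY u] evaluated at [x]; letting [x] vary kills each
    coefficient of [swapXY u]. *)
Lemma closed_bipoly_eq0 (K : closedFieldType) (u : {poly {poly K}}) :
  (forall x y, u.[x%:P].[y] = 0) -> u = 0.
Proof.
move=> u0; apply/eqP; rewrite -swapXY_eq0; apply/eqP/polyP => j.
rewrite coef0; apply: closed_poly_eq0 => x.
have : u.[x%:P] = 0 by apply: closed_poly_eq0.
by rewrite horner_polyC => /polyP/(_ j); rewrite coef_map coef0.
Qed.

Lemma map_polyC_map (R S : nzRingType) (f : {rmorphism R -> S}) (q : {poly R}) :
  map_poly (map_poly f) q^:P = (map_poly f q)^:P.
Proof. by apply/polyP => k; rewrite !coef_map /= map_polyC. Qed.

Lemma map_poly_XaY (R S : nzRingType) (f : {rmorphism R -> S}) (q : {poly R}) :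
  map_poly (map_poly f) (poly_XaY q) = poly_XaY (map_poly f q).
Proof.
by rewrite /poly_XaY map_comp_poly map_polyC_map rmorphD /= map_polyX
  map_polyC /= map_polyX.
Qed.

(** Additivity in the form that [binomial_seq] requires, an identity in two indeterminates, free of
    any evaluation in [Fbar]. *)
Definition formally_additive {R : nzRingType} (q : {poly R}) : Prop :=
  poly_XaY q = q^:P + q%:P.

(** The coefficient embedding into [Fbar] is injective, so the identity can be tested there; over an
    algebraically closed field, agreement at all pairs of points suffices. *)
Lemma additive_poly_formally (F : fieldType) (Fbar : closedFieldType)
    (iota : {rmorphism F -> Fbar}) (q : {poly F}) :
  additive_poly iota q -> formally_additive q.
Proof.
move=> q_add.
have inj2 : injective (map_poly (map_poly iota)).
  apply: map_inj_poly; last exact: rmorph0.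
  by apply: map_inj_poly (fmorph_inj iota) (rmorph0 iota).
apply: inj2; rewrite map_poly_XaY rmorphD /= map_polyC_map map_polyC /=.
apply/eqP; rewrite -subr_eq0; apply/eqP/closed_bipoly_eq0 => x y.
by rewrite !hornerE horner_poly_XaY !(hornerE, horner_comp) q_add subrr.
Qed.

Lemma formally_additive0 {R : nzRingType} : formally_additive (0 : {poly R}).
Proof. by rewrite /formally_additive poly_XaY0 rmorph0 polyC0 addr0. Qed.

Lemma formally_additiveD {R : nzRingType} (q r : {poly R}) :
  formally_additive q -> formally_additive r -> formally_additive (q + r).
Proof.
rewrite /formally_additive /poly_XaY => q_add r_add.
by rewrite rmorphD comp_polyD q_add r_add polyCD addrACA.
Qed.

(** Compare coefficients at [m + n]: the product is a binomial multiple of one divided element, and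
    that binomial is a constant polynomial. *)
Lemma dp_elem_mul_eq0 (F : fieldType) (m n : nat) :
  'DP_m * 'DP_n = 0 :> dpseries {poly F} -> 'C(m + n, m)%:R = 0 :> F.
Proof.
rewrite dp_elemM => /(congr1 (fun f => dpcoef f (m + n))) /=.
rewrite eqxx mulr1 -polyC_natr => /eqP; rewrite polyC_eq0 => /eqP.
by rewrite -(bin_sub (leq_addl m n)) addnK.
Qed.

Theorem proposition6 (F : fieldType) (p : nat) (pcharFp : p \in [pchar F])
    (Fbar : closedFieldType) (iota : {rmorphism F -> Fbar})
    (Fbar_closure : is_alg_closure iota)
    (i : nat -> nat) (e : nat -> {poly F})
    (X_null : null_seq (fun j => 'DP_(i j) : dpseries {poly F}))
    (E_additive : forall j, additive_poly iota (e j))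
    (summable_XE : dp_summable (fun j => e j *: 'DP_(i j))) :
  f_XE i e \in BDstar F.
Proof.
pose q n := dpcoef (dp_sum (fun j => e j *: 'DP_(i j))) n.
have q_add n : formally_additive (q n).
  (* The sum over [j] runs over a finite set, so closure under 0 and addition is enough. *)
  rewrite /q /=; apply: big_ind => [||j _].
  - exact: formally_additive0.
  - exact: formally_additiveD.
  rewrite mulr_natr; have [_|_] := eqVneq n (i j).
    by rewrite mulr1n; exact: additive_poly_formally (E_additive j).
  by rewrite mulr0n; exact: formally_additive0.
have q_supp n : q n != 0 -> exists j, i j = n.
  move=> qn; apply: contrapT => no_j; case/eqP: qn.
  rewrite /q /=; apply: fsbig1 => j _; have [nij|_] := eqVneq n (i j).
    by case: no_j; exists j.
  by rewrite mulr0.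
have q_null m n : (q m)^:P * (q n)%:P *+ 'C(m + n, m) = 0.
  have [->|/q_supp[j <-]] := eqVneq (q m) 0.
    by rewrite rmorph0 mul0r mul0rn.
  have [->|/q_supp[k <-]] := eqVneq (q n) 0.
    by rewrite polyC0 mulr0 mul0rn.
  by rewrite -mulr_natr -!polyC_natr (dp_elem_mul_eq0 _ _ _ (X_null j k)) !polyC0 mulr0.
(* The index 0 cannot occur in a null sequence, because the square of ['DP_0 = 1] is not zero. *)
have q0 : q 0%N = 0.
  apply/eqP/negPn/negP => /q_supp[j ij0]; have := X_null j j.
  by rewrite /= ij0 dp_elem0 mulr1 => /eqP; rewrite oner_eq0.
(* The summand [(n == 0%N)%:R] is the [n]-th coefficient of the unit ['DP_0]. *)
pose P n : {poly F} := (n == 0%N)%:R + q n.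
have P0 : P 0%N = 1 by rewrite /P q0 addr0.
have PS n : P n.+1 = q n.+1 by rewrite /P add0r.
rewrite inE; exists P => //=; split; last first.
  by exists 0%N; rewrite P0 oner_neq0.
case=> [|n].
  by rewrite big_ord1 /= P0 /poly_XaY rmorph1 comp_polyC polyC1 mulr1.
rewrite big_ord_recl big_ord_recr /= big1 => [|k _]; last first.
  (* The inner indices are [k.+1] and [(n - k.+1).+1]; both are positive, so [P] agrees with [q] at
     each. *)
  rewrite /bump /= add1n subSS -(subnSK (ltn_ord k)) !PS.
  by have := q_null k.+1 (n - k.+1).+1; rewrite addnS subnKC.
rewrite /bump /= add1n subn0 subnn P0 PS rmorph1 polyC1 mul1r mulr1 bin0 binn.
by rewrite !mulr1n add0r addrC; exact: q_add.
Qed.
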